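(* Let $G=(V,E)$ be a $(D,L)$-Bonnet-Myers sharp graph and let $x,y\in V$ with $d(x,y)=L$. Then any vertex $u\in V$ lies on a geodesic from $x$ to $y$, that is, $[x,y]=V$.
   Context: All graphs are finite, simple, undirected, unweighted, connected, and have at least one edge. $d$ denotes the combinatorial distance and $\mathrm{diam}(G)=\max_{x,y}d(x,y)$; $x\sim y$ means that $x,y$ are adjacent. A geodesic is a shortest path, and the interval between $x,y\in V$ is $[x,y]=\{z\in V:d(x,z)+d(z,y)=d(x,y)\}$, the set of vertices lying on geodesics from $x$ to $y$. For a $D$-regular graph $G=(V,E)$ and $x\in V$, let $\mu_x$ be the probability measure on $V$ giving mass $\frac1{D+1}$ to $x$ and to each of its $D$ neighbours. The Wasserstein distance of probability measures $\mu,\nu$ on $V$ is $W_1(\mu,\nu)=\inf_\pi\sum_{u,v\in V}d(u,v)\pi(u,v)$, where $\pi:V\times V\to[0,1]$ runs over all couplings with marginals $\mu$ and $\nu$. The (modified) Ollivier Ricci curvature of two different vertices $x,y$ is $$\kappa(x,y)=\frac{D+1}{D}\left(1-\frac{W_1(\mu_x,\mu_y)}{d(x,y)}\right).$$ A $D$-regular graph $G$ of diameter $L$ is called $(D,L)$-Bonnet-Myers sharp if $\inf_{x\sim y}\kappa(x,y)=\frac2L$. *)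

(* Defs.v *)
From mathcomp Require Import all_boot all_order all_algebra.
From mathcomp Require Import classical_sets reals.
Set Implicit Arguments.
Unset Strict Implicit.
Unset Printing Implicit Defensive.
Import Order.TTheory GRing.Theory Num.Theory.

(* Finite simple connected graphs with at least one edge. *)
Record graph := Graph {
  vertex :> finType;
  adj : rel vertex;
  adj_sym : symmetric adj;
  adj_irr : irreflexive adj;
  adj_connected : forall x y, connect adj x y;
  adj_edge : exists x y, adj x y }.

(* A walk from x is given as in path.v: p lists its vertices after x, so that
   size p is the number of edges. *)
Definition walk (G : graph) (x y : G) (p : seq G) : bool :=
  path (@adj G) x p && (last x p == y).

Definition has_walk (G : graph) (x y : G) (n : nat) : bool :=
  [exists p : n.-tuple G, walk x y p].

Lemma has_walk_ex (G : graph) (x y : G) : exists n, has_walk x y n.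
Proof.
have /connectP[p path_p ->] := adj_connected x y.
by exists (size p); apply/existsP; exists (in_tuple p); apply/andP.
Qed.

Definition dist (G : graph) (x y : G) : nat := ex_minn (has_walk_ex x y).

Definition diam (G : graph) : nat := \max_(x : G) \max_(y : G) dist x y.

Definition geodesic (G : graph) (x y : G) (p : seq G) : bool :=
  walk x y p && (size p == dist x y).

Definition geod_interval (G : graph) (x y : G) : {set G} :=
  finset (fun z : G => dist x z + dist z y == dist x y)%N.

Definition regular (G : graph) (D : nat) : Prop :=
  forall x : G, #|@adj G x| = D.

Local Open Scope classical_set_scope.
Local Open Scope ring_scope.

(* Measures on the vertex set are represented by their mass functions. *)
Definition ball_measure (R : realType) (G : graph) (D : nat) (x : G) : G -> R :=
  fun y => if (y == x) || adj x y then D.+1%:R^-1 else 0.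

Definition coupling (R : realType) (G : graph) (mu nu : G -> R)
    (pi : G -> G -> R) : Prop :=
  [/\ forall u v, 0 <= pi u v <= 1,
      forall u, \sum_(v : G) pi u v = mu u
    & forall v, \sum_(u : G) pi u v = nu v].

Definition cost (R : realType) (G : graph) (pi : G -> G -> R) : R :=
  \sum_(u : G) \sum_(v : G) (dist u v)%:R * pi u v.

Definition W1 (R : realType) (G : graph) (mu nu : G -> R) : R :=
  inf [set c : R | exists2 pi, coupling mu nu pi & c = cost pi].

Definition kappa (R : realType) (G : graph) (D : nat) (x y : G) : R :=
  D.+1%:R / D%:R *
  (1 - W1 (ball_measure R D x) (ball_measure R D y) / (dist x y)%:R).

Definition Bonnet_Myers_sharp (R : realType) (G : graph) (D L : nat) : Prop :=
  [/\ regular G D, diam G = L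
    & inf [set k : R | exists x y : G, adj x y /\ k = kappa R D x y]
      = 2 / L%:R].

(* Main.v *)
Require Import Defs.
From mathcomp Require Import all_boot all_order all_algebra.
From mathcomp Require Import classical_sets reals.
From mathcomp Require Import ring.

(** Write [W(a,b)] for the transport distance of the ball measures of [a] and
    [b], and [w = 1 - 2D / ((D+1)L)].  The infimum condition says that
    [W(a,b) <= w] on every edge.  The easy half of Kantorovich duality then
    bounds the growth of ball averages: if [phi] is 1-Lipschitz, its average
    over the ball of the endpoint of a walk with [n] edges exceeds its average
    over the ball of the starting point by at most [n w]
    ([ball_mean_walk_le]).

    Let [z] lie in [[x,y]].  The average of [d(x,.)] over the ball of [x] is
    [D/(D+1)], and so is that of [d(y,.)] over the ball of [y].  Following
    geodesics from [x] to [z] and from [y] to [z], the average of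
    [d(x,.) + d(y,.)] over the ball of [z] is at most
    [2D/(D+1) + d(x,z) w + d(y,z) w = 2D/(D+1) + L w = L].
    But [d(x,.) + d(y,.) >= L] everywhere by the triangle inequality, so it
    equals [L] on the whole ball of [z].  Thus [[x,y]] contains the neighbours
    of each of its vertices; it contains [x], and the graph is connected. *)

Set Implicit Arguments.
Unset Strict Implicit.
Unset Printing Implicit Defensive.
Import Order.TTheory GRing.Theory Num.Theory.

(** * Combinatorial distance and geodesics *)

Section Distance.
Variable G : graph.
Implicit Types (x y z : G) (p : seq G).

Lemma dist_geodesic x y : exists p, geodesic x y p.
Proof.
rewrite /geodesic /dist; case: ex_minnP => n /existsP[p wp] _.
by exists p; rewrite wp size_tuple eqxx.
Qed.

Lemma dist_walk_le x y p : walk x y p -> dist x y <= size p.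
Proof.
move=> wp; rewrite /dist; case: ex_minnP => n _; apply.
by apply/existsP; exists (in_tuple p).
Qed.

Lemma walk_cat x y z p q : walk x y p -> walk y z q -> walk x z (p ++ q).
Proof.
move=> /andP[pp /eqP lp] /andP[pq lq].
by rewrite /walk cat_path last_cat lp pp pq lq.
Qed.

Lemma dist_self x : dist x x = 0.
Proof.
by apply/eqP; rewrite -leqn0 (@dist_walk_le x x [::]) // /walk /= eqxx.
Qed.

Lemma dist_triangle x y z : dist x z <= dist x y + dist y z.
Proof.
have [p /andP[wp /eqP <-]] := dist_geodesic x y.
have [q /andP[wq /eqP <-]] := dist_geodesic y z.
by rewrite -size_cat dist_walk_le // (walk_cat wp wq).
Qed.

Lemma dist_sym x y : dist x y = dist y x.
Proof.
suff le (a b : G) : dist a b <= dist b a by apply/eqP; rewrite eqn_leq !le.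
have [p /andP[/andP[pp /eqP lp] /eqP <-]] := dist_geodesic b a.
rewrite -(size_belast b p) -(size_rev (belast b p)).
apply: dist_walk_le; rewrite /walk -lp rev_path.
rewrite (eq_path (e' := @adj G)) ?pp => [|u v]; last exact: adj_sym.
by case: p {pp lp} => [|c p] /=; rewrite ?rev_cons ?last_rcons eqxx.
Qed.

Lemma dist_adj x y : adj x y -> dist x y = 1.
Proof.
move=> axy; apply/eqP; rewrite eqn_leq; apply/andP; split.
  by apply: (@dist_walk_le x y [:: y]); rewrite /walk /= axy eqxx.
have [[|z p] /andP[/andP[_ /eqP /= lp] /eqP <-]] // := dist_geodesic x y.
by rewrite lp adj_irr in axy.
Qed.

Lemma geod_interval_geodesic x y u :
  u \in geod_interval x y -> exists2 p, geodesic x y p & u \in x :: p.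
Proof.
rewrite inE => /eqP dxuy.
have [p /andP[wp /eqP sp]] := dist_geodesic x u.
have [q /andP[wq /eqP sq]] := dist_geodesic u y.
exists (p ++ q).
  by rewrite /geodesic (walk_cat wp wq) size_cat sp sq dxuy eqxx.
have /andP[_ /eqP <-] := wp.
by rewrite -cat_cons mem_cat mem_last.
Qed.

Lemma adj_closed_setT (A : {set G}) x :
  x \in A -> (forall a b, a \in A -> adj a b -> b \in A) -> A = finset.setT.
Proof.
move=> xA closedA; apply/setP=> u; rewrite finset.in_setT.
have /connectP[p pp ->] := adj_connected x u.
by elim: p x xA pp => //= a p IHp x xA /andP[axa]; apply/IHp/(closedA x).
Qed.

Lemma dist_le_diam x y : dist x y <= diam G.
Proof.
apply: leq_trans (leq_bigmax x).
exact: (leq_bigmax (F := fun y => dist x y)).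
Qed.

End Distance.

Local Open Scope ring_scope.

(** * The easy half of Kantorovich duality *)

Section Transport.
Variables (R : realType) (G : graph).
Implicit Types (mu nu phi : G -> R) (x y z : G).

Definition lipschitz1 phi := forall u v, phi v - phi u <= (dist u v)%:R.

Lemma lipschitz1_dist x : lipschitz1 (fun v => (dist x v)%:R).
Proof. by move=> u v; rewrite lerBlDl -natrD ler_nat dist_triangle. Qed.

(** This makes the set of transport costs nonempty, so that a lower bound of
    all costs is a lower bound of their infimum. *)
Lemma product_coupling mu nu :
  (forall u, 0 <= mu u <= 1) -> (forall u, 0 <= nu u <= 1) ->
  \sum_u mu u = 1 -> \sum_u nu u = 1 ->
  coupling mu nu (fun u v => mu u * nu v).
Proof.
move=> mu01 nu01 mu1 nu1; split=> [u v|u|v].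
- have /andP[? ?] := mu01 u; have /andP[? ?] := nu01 v.
  by rewrite mulr_ge0 ?mulr_ile1.
- by rewrite -mulr_sumr nu1 mulr1.
- by rewrite -mulr_suml mu1 mul1r.
Qed.

(** Integrate [phi v - phi u <= d(u,v)] against the coupling. *)
Lemma lipschitz1_le_cost mu nu pi phi :
  coupling mu nu pi -> lipschitz1 phi ->
  \sum_v phi v * nu v - \sum_u phi u * mu u <= cost pi.
Proof.
move=> [pi01 pil pir] lip.
have -> : \sum_v phi v * nu v = \sum_u \sum_v phi v * pi u v.
  by rewrite exchange_big; apply: eq_bigr => v _; rewrite -mulr_sumr pir.
have -> : \sum_u phi u * mu u = \sum_u \sum_v phi u * pi u v.
  by apply: eq_bigr => u _; rewrite -mulr_sumr pil.
rewrite -sumrB; apply: ler_sum => u _.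
rewrite -sumrB; apply: ler_sum => v _.
by rewrite -mulrBl ler_wpM2r //; have /andP[] := pi01 u v.
Qed.

Lemma lipschitz1_le_W1 mu nu phi :
  (exists pi, coupling mu nu pi) -> lipschitz1 phi ->
  \sum_v phi v * nu v - \sum_u phi u * mu u <= W1 mu nu.
Proof.
move=> [pi cpi] lip; apply: lb_le_inf; first by exists (cost pi); exists pi.
by move=> _ [pi' cpi' ->]; apply: lipschitz1_le_cost.
Qed.

End Transport.

(** * Averages over unit balls *)

Section BallMeasure.
Variables (R : realType) (G : graph) (D : nat).
Hypothesis regG : regular G D.
Implicit Types (phi : G -> R) (x y z : G).

Lemma ball_measure_ge0 x v : 0 <= ball_measure R D x v.
Proof. by rewrite /ball_measure; case: ifP; rewrite // invr_ge0. Qed.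

Lemma sum_ball_measure phi x :
  \sum_v phi v * ball_measure R D x v =
  (phi x + \sum_(v | adj x v) phi v) / D.+1%:R.
Proof.
transitivity (\sum_(v | (v == x) || adj x v) phi v / D.+1%:R).
  rewrite [RHS]big_mkcond; apply: eq_bigr => v _.
  by rewrite /ball_measure; case: ifP; rewrite ?mulr0.
rewrite -mulr_suml (bigD1 x) ?eqxx //=; congr ((_ + _) / _).
apply: eq_bigl => v; have [->|] := eqVneq v x; last by rewrite andbT.
by rewrite adj_irr.
Qed.

Lemma sum_ball_measure_const c x : \sum_v c * ball_measure R D x v = c.
Proof.
rewrite (sum_ball_measure (fun=> c)) sumr_const.
rewrite (_ : #|_| = D); last exact: regG.
by rewrite -mulrS -[c *+ _]mulr_natr mulfK ?pnatr_eq0.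
Qed.

Lemma ball_measure_total x : \sum_v ball_measure R D x v = 1.
Proof.
rewrite -[RHS](sum_ball_measure_const 1 x).
by apply: eq_bigr => v _; rewrite mul1r.
Qed.

Lemma ball_measure_coupling x y :
  exists pi, coupling (ball_measure R D x) (ball_measure R D y) pi.
Proof.
have b01 z u : 0 <= ball_measure R D z u <= 1.
  rewrite ball_measure_ge0 /ball_measure /=; case: ifP => // _.
  by rewrite invf_le1 ?ler1n.
by eexists; apply: product_coupling; rewrite ?ball_measure_total.
Qed.

Lemma sum_ball_measure_dist x :
  \sum_v (dist x v)%:R * ball_measure R D x v = D%:R / D.+1%:R.
Proof.
rewrite (sum_ball_measure (fun v => (dist x v)%:R)) dist_self add0r.
rewrite (eq_bigr (fun=> 1)) => [|v axv]; last by rewrite dist_adj.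
rewrite sumr_const; congr (_ *+ _ / _); exact: regG.
Qed.

(** The mass function is positive on the ball, so an integral equal to the
    minimal possible value forces pointwise equality there. *)
Lemma ball_mean_le_min c phi z :
  (forall v, c <= phi v) -> \sum_v phi v * ball_measure R D z v <= c ->
  forall v, adj z v -> phi v = c.
Proof.
move=> cphi mean_le v azv.
have ge0 u : true -> 0 <= (phi u - c) * ball_measure R D z u.
  by move=> _; rewrite mulr_ge0 ?ball_measure_ge0 ?subr_ge0.
have sum0 : \sum_u (phi u - c) * ball_measure R D z u = 0.
  apply/le_anti; rewrite sumr_ge0 // andbT.
  under eq_bigr do rewrite mulrBl.
  by rewrite sumrB sum_ball_measure_const subr_le0.
have /eqP := psumr_eq0P ge0 sum0 (erefl : xpredT v).
by rewrite /ball_measure azv orbT mulf_eq0 invr_eq0 pnatr_eq0 orbF subr_eq0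
  => /eqP.
Qed.

Lemma ball_mean_walk_le w phi x z p :
  (forall a b : G, adj a b ->
    W1 (ball_measure R D a) (ball_measure R D b) <= w) ->
  lipschitz1 phi -> walk x z p ->
  \sum_v phi v * ball_measure R D z v <=
  \sum_v phi v * ball_measure R D x v + (size p)%:R * w.
Proof.
move=> W1_le lip; elim: p x => [|a p IHp] x /andP[/= pp /eqP lp].
  by rewrite mul0r addr0 lp.
have /andP[axa pp'] := pp.
have /IHp IH : walk a z p by rewrite /walk pp' lp eqxx.
apply: (le_trans IH); rewrite -natr1 mulrDl mul1r [_ * w + w]addrC addrA.
rewrite lerD2r -lerBlDl.
apply: le_trans (W1_le _ _ axa).
exact: lipschitz1_le_W1 (ball_measure_coupling x a) lip.
Qed.

Lemma kappa_ge_inf x y : adj x y ->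
  inf [set k : R | exists a b : G, adj a b /\ k = kappa R D a b]%classic
    <= kappa R D x y.
Proof.
move=> axy; apply: ge_inf; last by exists x, y.
(* A finite set of reals is bounded below by minus the sum of the moduli. *)
exists (- \sum_(ab : G * G) `|kappa R D ab.1 ab.2|) => _ [a [b [_ ->]]].
rewrite lerNl (bigD1 (a, b)) //= ler_wpDr ?sumr_ge0 //.
by rewrite -normrN ler_norm.
Qed.

End BallMeasure.

(** * Bonnet-Myers sharp graphs *)

Section Sharp.
Variables (R : realType) (G : graph) (D L : nat).
Hypothesis sharpG : Bonnet_Myers_sharp R G D L.

Let regG : regular G D. Proof. by case: sharpG. Qed.

Lemma sharp_diam_gt0 : (0 < L)%N.
Proof.
have [_ <- _] := sharpG; have [a [b aab]] := adj_edge G.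
by rewrite -(dist_adj aab) dist_le_diam.
Qed.

Lemma sharp_W1_le (a b : G) : adj a b ->
  W1 (ball_measure R D a) (ball_measure R D b)
    <= 1 - 2 * (D%:R / D.+1%:R) / L%:R.
Proof.
move=> aab; have := kappa_ge_inf R D aab.
have [_ _ ->] := sharpG; rewrite /kappa dist_adj // divr1.
have D_gt0 : 0 < D%:R :> R.
  by rewrite ltr0n -(regG a); apply/card_gt0P; exists b.
have D1_gt0 : 0 < D.+1%:R :> R by rewrite ltr0n.
rewrite -ler_pdivrMl ?divr_gt0 // invf_div => le.
rewrite lerBrDl -lerBrDr; apply: le_trans le.
by rewrite [2 * _]mulrC -[_ * 2 / _]mulrA.
Qed.

(** The upper bounds for the averages of the distances to [x] and to [y] over
    the ball of [z] add up to exactly [L], the least value of the sum of these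
    two distances. *)
Lemma sharp_geod_interval_adj (x y z u : G) : dist x y = L ->
  z \in geod_interval x y -> adj z u -> u \in geod_interval x y.
Proof.
move=> dxy; rewrite !inE => /eqP dxzy azu.
have mean_le a : \sum_v (dist a v)%:R * ball_measure R D z v <=
    D%:R / D.+1%:R + (dist a z)%:R * (1 - 2 * (D%:R / D.+1%:R) / L%:R).
  have [p /andP[wp /eqP <-]] := dist_geodesic a z.
  rewrite -[X in X + _](sum_ball_measure_dist R regG a).
  exact: (ball_mean_walk_le regG sharp_W1_le (lipschitz1_dist R a) wp).
have L0 : L%:R != 0 :> R by rewrite pnatr_eq0 -lt0n sharp_diam_gt0.
have := @ball_mean_le_min R G D regG L%:R
  (fun v => (dist x v)%:R + (dist y v)%:R) z.
move=> /(_ _ _ u azu) sum_eq.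
rewrite dxy -(eqr_nat R) natrD [dist u y]dist_sym sum_eq // => [v|].
  by rewrite -natrD ler_nat -dxy [dist y v]dist_sym dist_triangle.
under eq_bigr do rewrite mulrDl.
rewrite big_split /=; apply: (le_trans (lerD (mean_le x) (mean_le y))).
move: (D%:R / D.+1%:R) => q; rewrite [dist y z]dist_sym addrACA -mulrDl -natrD.
rewrite dxzy dxy le_eqVlt; apply/orP; left; apply/eqP.
by field.
Qed.

End Sharp.

Theorem theorem5p5 (R : realType) (G : graph) (D L : nat)
    (sharpG : Bonnet_Myers_sharp R G D L) (x y : G) (dxy : dist x y = L) :
  (forall u : G, exists2 p : seq G, geodesic x y p & u \in x :: p) /\
  geod_interval x y = finset.setT.
Proof.
have all_in : geod_interval x y = finset.setT.
  apply: (@adj_closed_setT G _ x) => [|a b]; first by rewrite inE dist_self.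
  exact: (sharp_geod_interval_adj sharpG).
by split=> // u; apply: geod_interval_geodesic; rewrite all_in finset.in_setT.
Qed.
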